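(* Let $X$ be a random variable satisfying assumption (A1), with CDF $F_X$, and let $Q$ be a BUM function. For each $K$, let $\boldsymbol{v}^{(K)}=(v^{(K)}_1,\dots,v^{(K)}_K)$ be $K$ i.i.d. samples of $X$. Then $$\lim_{K\to\infty}\mathrm{OWA}^{\mathrm d}_Q(\boldsymbol{v}^{(K)})=\rho_Q(X)\quad\text{(almost surely)}.$$
   Context: A basic unit monotone (BUM) function is a function $Q:[0,1]\to[0,1]$ with $Q(0)=0$, $Q(1)=1$ and $Q(x)\ge Q(y)$ for $x>y$ (it need not be continuous). For $\boldsymbol{v}\in\mathbb{R}^K$, the discrete OWA operator is $\mathrm{OWA}^{\mathrm d}_Q(\boldsymbol{v})=\sum_{i=1}^K\left(Q\left(\frac{i}{K}\right)-Q\left(\frac{i-1}{K}\right)\right)v_{\pi(i)}$, where $\pi$ is a permutation of $\{1,\dots,K\}$ with $v_{\pi(1)}\ge v_{\pi(2)}\ge\dots\ge v_{\pi(K)}$. For a random variable $X$ with CDF $F_X$, $\mathrm{VaR}_t(X)=\inf\{y\in\mathbb{R}: F_X(y)\ge t\}$ for $t\in(0,1]$ and $\mathrm{VaR}_0(X)=\inf\{y\in\mathbb{R}:F_X(y)>0\}$. Assumption (A1): there exist $\underline{x},\overline{x}\in\mathbb{R}$ such that $\Pr[X\in[\underline{x},\overline{x}]]=1$, and $t\mapsto \mathrm{VaR}_t(X)$ is continuous on $[0,1]$. The distortion risk measure is the Riemann–Stieltjes integral $\rho_Q(X)=\int_0^1 \mathrm{VaR}_{1-t}(X)\,dQ(t)$.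 *)

(* Defs.v *)
From HB Require Import structures.
From mathcomp Require Import all_boot all_order all_algebra all_fingroup.
From mathcomp Require Import all_classical all_reals all_analysis.

Set Implicit Arguments.
Unset Strict Implicit.
Unset Printing Implicit Defensive.

Import Order.TTheory GRing.Theory Num.Theory.
Import numFieldNormedType.Exports.

Local Open Scope classical_set_scope.
Local Open Scope ring_scope.

(* [Q] is a total function on [R]; only its values on [0, 1] are constrained,
   and only those are used below. *)
Definition BUM (R : realType) (Q : R -> R) : Prop :=
  [/\ forall x, 0 <= x <= 1 -> 0 <= Q x <= 1,
      Q 0 = 0,
      Q 1 = 1 &
      forall x y, 0 <= x <= 1 -> 0 <= y <= 1 -> y < x -> Q y <= Q x].

Definition is_sorting_perm (R : realType) (K : nat) (v : 'I_K -> R)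
    (s : 'S_K) : bool :=
  [forall i : 'I_K, forall j : 'I_K, (i <= j)%N ==> (v (s j) <= v (s i))].

Lemma sorting_perm_exists (R : realType) (K : nat) (v : 'I_K -> R) :
  exists s : 'S_K, is_sorting_perm v s.
Proof.
pose t := [tuple v i | i < K].
have /tuple_permP[s ts] :
    perm_eq (sort_tuple (fun x y : R => y <= x) t) t.
  by rewrite /= perm_sort.
exists s; apply/forallP => i; apply/forallP => j; apply/implyP => ij.
have vs k : v (s k) = nth 0 (sort (fun x y : R => y <= x) t) k.
  have -> : sort (fun x y : R => y <= x) t = [tuple tnth t (s i) | i < K] :> seq R.
    exact: ts.
  by rewrite -(tnth_nth 0) !tnth_mktuple.
have ge_tr : transitive (fun x y : R => y <= x).
  by move=> y x z yx zy; exact: le_trans yx.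
rewrite !vs; apply: (sorted_leq_nth ge_tr) => //.
- by apply: sort_sorted => x y; rewrite orbC; exact: le_total.
- by rewrite inE size_sort size_tuple.
- by rewrite inE size_sort size_tuple.
Qed.

Definition sorting_perm (R : realType) (K : nat) (v : 'I_K -> R) : 'S_K :=
  xchoose (sorting_perm_exists v).

(* The index [i : 'I_K] counts from 0, so it carries the weight
   [Q ((i + 1) / K) - Q (i / K)]. The value does not depend on which sorting
   permutation is chosen, since two of them give the same sorted vector. *)
Definition OWAd (R : realType) (Q : R -> R) (K : nat) (v : 'I_K -> R) : R :=
  \sum_(i < K) (Q (i.+1%:R / K%:R) - Q (i%:R / K%:R)) * v (sorting_perm v i).

(* The infima are taken in [R], where [inf] is 0 on sets that are empty or not
   bounded below. This does not happen for a bounded random variable and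
   [t] in [0, 1]. *)
Definition VaR (R : realType) (d : measure_display) (T : measurableType d)
    (P : probability T R) (X : {RV P >-> R}) (t : R) : R :=
  if t == 0 then inf [set y : R | (0 < cdf X y)%E]
  else inf [set y : R | (t%:E <= cdf X y)%E].

Definition assumptionA1 (R : realType) (d : measure_display)
    (T : measurableType d) (P : probability T R) (X : {RV P >-> R}) : Prop :=
  (exists xlo xhi : R, P (X @^-1` `[xlo, xhi]) = 1%E) /\
  {within `[0, 1], continuous (VaR X)}.

(* For [itv_partition a b s], the partition points are [a :: s], with last
   point [b]; [xi k] is the tag of the [k]-th cell. *)
Definition RS_sum (R : realType) (f g : R -> R) (a b : R) (s : seq R)
    (xi : nat -> R) : R :=
  \sum_(0 <= k < size s)
    f (xi k) * (g (nth b (a :: s) k.+1) - g (nth b (a :: s) k)).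

Definition is_RS_integral (R : realType) (f g : R -> R) (a b I : R) : Prop :=
  forall e : R, 0 < e -> exists2 delta : R, 0 < delta &
    forall (s : seq R) (xi : nat -> R),
      itv_partition a b s ->
      (forall k, (k < size s)%N ->
        nth b (a :: s) k.+1 - nth b (a :: s) k < delta /\
        nth b (a :: s) k <= xi k <= nth b (a :: s) k.+1) ->
      `|RS_sum f g a b s xi - I| < e.

(* The limit of the sums as the mesh tends to 0, and 0 if there is none. *)
Definition RS_integral (R : realType) (f g : R -> R) (a b : R) : R :=
  xget 0 [set I | is_RS_integral f g a b I].

Definition distortion_risk (R : realType) (d : measure_display)
    (T : measurableType d) (P : probability T R) (Q : R -> R)
    (X : {RV P >-> R}) : R :=
  RS_integral (fun t => VaR X (1 - t)) Q 0 1.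

Definition mutually_independent (R : realType) (d : measure_display)
    (T : measurableType d) (P : probability T R) (I : finType)
    (Y : I -> {RV P >-> R}) : Prop :=
  forall (J : {set I}) (A : I -> set R), (forall i, measurable (A i)) ->
    P (\bigcap_(i in [set` J]) (Y i @^-1` A i)) =
    (\prod_(i in J) P (Y i @^-1` A i))%E.

(* [X] enters only through its law: the samples may live on another
   probability space. *)
Definition iid_samples (R : realType)
    (d : measure_display) (T : measurableType d) (P : probability T R)
    (X : {RV P >-> R})
    (d' : measure_display) (T' : measurableType d') (P' : probability T' R)
    (K : nat) (v : 'I_K -> {RV P' >-> R}) : Prop :=
  mutually_independent v /\
  forall (i : 'I_K) (A : set R), measurable A ->
    distribution P' (v i) A = distribution P X A.

(* Main.v *)
(* Write q = VaR X, which is uniformly continuous on [0, 1]. Chernoff's bound and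
   Borel-Cantelli, which apply to triangular arrays, control almost surely the
   fraction of samples above q(j/m) + 1/m and below q(j/m) - 1/m for every grid
   point j/m. These fractions locate every order statistic: the i-th largest of
   K samples (counting from 0) is within a prescribed error of q(1 - i/K),
   uniformly in i, once K is large. Since the weights of OWAd are nonnegative
   and sum to 1, OWAd is then close to the Riemann-Stieltjes sum of t |-> q(1 - t)
   against Q over the uniform partition, which converges to the integral. *)

Require Import Defs.
From HB Require Import structures.
From mathcomp Require Import all_boot all_order all_algebra all_fingroup.
From mathcomp Require Import all_classical all_reals all_analysis.
From mathcomp Require Import ring lra.

Set Implicit Arguments.
Unset Strict Implicit.
Unset Printing Implicit Defensive.

Import Order.TTheory GRing.Theory Num.Theory.
Import numFieldNormedType.Exports.

Local Open Scope classical_set_scope.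
Local Open Scope ring_scope.

(** * Uniform continuity on a segment *)

(** Heine-Cantor, from the near-covering form of compactness: around each x every small delta works,
    by the triangle inequality through [f x], and compactness gives one delta for all of [a, b]. *)
Lemma within_segment_uniformly_continuous (R : realType) (f : R -> R) (a b : R) :
  {within `[a, b], continuous f} ->
  forall e : R, 0 < e -> exists2 delta, 0 < delta & forall x y,
    a <= x <= b -> a <= y <= b -> `|x - y| < delta -> `|f x - f y| < e.
Proof.
move=> /subspace_continuousP cf e e0.
have cov := (compact_near_coveringP _).1 (@segment_compact R a b).
have [] := cov R 0^'+ (fun delta x => forall y,
  a <= x <= b -> a <= y <= b -> `|x - y| < delta -> `|f x - f y| < e) _.
  move=> x xab; have e20 : 0 < e / 2 by rewrite divr_gt0.
  have /cvgrPdist_lt/(_ _ e20) := cf x xab.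
  case=> /= r r0 xr; have r20 : 0 < r / 2 by rewrite divr_gt0.
  near=> z delta => y /= zab yab zy.
  have xz : `|x - z| < r / 2 by near: z; exact: nbhsx_ballx.
  have dr : delta < r / 2 by near: delta; exact: nbhs_right_lt.
  have fz : `|f x - f z| < e / 2.
    apply: xr; rewrite /= ?in_itv//= (lt_trans xz)//; lra.
  have fy : `|f x - f y| < e / 2.
    apply: xr; rewrite /= ?in_itv//=.
    rewrite (le_lt_trans (ler_distD z _ _))//; lra.
  rewrite (le_lt_trans (ler_distD (f x) _ _))// (distrC (f z)); lra.
move=> delta /= d0 H; exists (delta / 2); first by rewrite divr_gt0.
move=> x y xab; apply: (H (delta / 2)) => //=; rewrite ?divr_gt0//.
by rewrite sub0r normrN gtr0_norm ?divr_gt0//; lra.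
Unshelve. all: by end_near. Qed.

(** * Comparison of two Riemann-Stieltjes sums *)

Definition clamp (R : realDomainType) (lo hi x : R) := Num.max lo (Num.min hi x).

Lemma clamp_in (R : realDomainType) (lo hi x : R) : lo <= hi ->
  lo <= clamp lo hi x <= hi.
Proof. by move=> lohi; rewrite /clamp le_max lexx ge_max lohi ge_min lexx. Qed.

Lemma le_clamp (R : realDomainType) (lo hi : R) :
  {homo clamp lo hi : x y / x <= y}.
Proof. by move=> x y xy; rewrite /clamp le_max2 // le_min2. Qed.

Lemma clamp_id (R : realDomainType) (lo hi x : R) : lo <= x <= hi ->
  clamp lo hi x = x.
Proof. by move=> /andP[lox xhi]; rewrite /clamp min_r// max_r. Qed.

Lemma clamp_lo (R : realDomainType) (lo hi x : R) : lo <= hi -> x <= lo ->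
  clamp lo hi x = lo.
Proof. by move=> lohi xlo; rewrite /clamp max_l// ge_min xlo orbT. Qed.

Lemma clamp_hi (R : realDomainType) (lo hi x : R) : lo <= hi -> hi <= x ->
  clamp lo hi x = hi.
Proof. by move=> lohi hix; rewrite /clamp min_l// max_r. Qed.

(** Both sides are the [g]-mass of the intersection of [a, b] and [x, y], and are 0 when these are
    disjoint. *)
Lemma clamp_swap (R : realDomainType) (g : R -> R) (a b x y : R) :
  a <= b -> x <= y ->
  g (clamp a b y) - g (clamp a b x) = g (clamp x y b) - g (clamp x y a).
Proof.
move=> ab xy.
have [ya|ay] := leP y a.
  by rewrite !(clamp_lo ab) ?(le_trans xy)// !(clamp_hi xy) ?(le_trans ya)// !subrr.
have [bx|xb] := leP b x.
  by rewrite !(clamp_hi ab) ?(le_trans bx)// !(clamp_lo xy) ?(le_trans ab)// !subrr.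
have -> : clamp a b y = clamp x y b.
  by rewrite /clamp minC [LHS]max_r ?[RHS]max_r// le_min ?(ltW ay)// ?ab ?xy ?(ltW xb).
suff -> : clamp a b x = clamp x y a by [].
by rewrite /clamp !min_r ?(ltW ay)// ?(ltW xb)// maxC.
Qed.

Definition tagged_partition (R : realType) (a b delta : R) (s : seq R)
    (xi : nat -> R) : Prop :=
  itv_partition a b s /\
  forall k, (k < size s)%N ->
    nth b (a :: s) k.+1 - nth b (a :: s) k < delta /\
    nth b (a :: s) k <= xi k <= nth b (a :: s) k.+1.

Lemma itv_partition_nthS (R : realType) (a b : R) s k :
  itv_partition a b s -> (k < size s)%N ->
  nth b (a :: s) k <= nth b (a :: s) k.+1.
Proof. by move=> [+ _] ks => /(pathP b)/(_ k ks)/ltW. Qed.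

Section RS_compare.
Variables (R : realType) (f g : R -> R) (a b : R).
Hypothesis g_homo : forall x y, a <= x <= b -> a <= y <= b -> x <= y -> g x <= g y.

(** The first point [a] is clamped to [lo] and the last point [b] to [hi], so the sum telescopes. *)
Let g_clamp_telescope s lo hi : itv_partition a b s -> a <= lo -> lo <= hi -> hi <= b ->
  \sum_(0 <= k < size s) (g (clamp lo hi (nth b (a :: s) k.+1))
     - g (clamp lo hi (nth b (a :: s) k))) = g hi - g lo.
Proof.
move=> sp alo lohi hib.
rewrite (telescope_sumr (fun k => g (clamp lo hi (nth b (a :: s) k))))//.
by rewrite (itv_partition_nth_size b sp) clamp_hi// clamp_lo.
Qed.

(* No common refinement is needed: [m k l] is the [g]-mass of the intersection of
   the [k]-th cell of [s] and the [l]-th cell of [s'], and both sums are sums over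
   pairs of cells with these masses. *)
Lemma RS_sum_close (e delta : R) s xi s' xi' : 0 <= e ->
  (forall x y, a <= x <= b -> a <= y <= b -> `|x - y| < delta + delta -> `|f x - f y| <= e) ->
  tagged_partition a b delta s xi -> tagged_partition a b delta s' xi' ->
  `|RS_sum f g a b s xi - RS_sum f g a b s' xi'| <= e * (g b - g a).
Proof.
move=> e0 fe [sp sxi] [sp' sxi'].
pose t k := nth b (a :: s) k; pose t' k := nth b (a :: s') k.
have tab k : (k <= size s)%N -> a <= t k <= b.
  by move=> ks; rewrite itv_partition_nth_ge ?itv_partition_nth_le.
have tab' k : (k <= size s')%N -> a <= t' k <= b.
  by move=> ks; rewrite itv_partition_nth_ge ?itv_partition_nth_le.
pose m k l := g (clamp (t' l) (t' l.+1) (t k.+1)) - g (clamp (t' l) (t' l.+1) (t k)).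
have mt k l : (k < size s)%N -> (l < size s')%N ->
    m k l = g (clamp (t k) (t k.+1) (t' l.+1)) - g (clamp (t k) (t k.+1) (t' l)).
  by move=> ks ls; rewrite /m clamp_swap// itv_partition_nthS.
have sum_m l : (l < size s')%N -> \sum_(0 <= k < size s) m k l = g (t' l.+1) - g (t' l).
  move=> ls; apply: g_clamp_telescope => //; last 2 first.
  - exact: itv_partition_nthS.
  - by have /andP[] := tab' _ ls.
  by have /andP[] := tab' _ (ltnW ls).
have sum_m' k : (k < size s)%N -> \sum_(0 <= l < size s') m k l = g (t k.+1) - g (t k).
  move=> ks; rewrite -(g_clamp_telescope sp'); first last.
  - by have /andP[] := tab _ ks.
  - exact: itv_partition_nthS.
  - by have /andP[] := tab _ (ltnW ks).
  by rewrite !big_nat; apply: eq_bigr => l /andP[_ ls]; exact: mt.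
have -> : RS_sum f g a b s xi - RS_sum f g a b s' xi' =
    \sum_(0 <= k < size s) \sum_(0 <= l < size s') (f (xi k) - f (xi' l)) * m k l.
  have -> : RS_sum f g a b s xi =
      \sum_(0 <= k < size s) \sum_(0 <= l < size s') f (xi k) * m k l.
    rewrite /RS_sum !big_nat; apply: eq_bigr => k /andP[_ ks].
    by rewrite -mulr_sumr sum_m'.
  have -> : RS_sum f g a b s' xi' =
      \sum_(0 <= k < size s) \sum_(0 <= l < size s') f (xi' l) * m k l.
    rewrite exchange_big_nat /= /RS_sum !big_nat; apply: eq_bigr => l /andP[_ ls].
    by rewrite -mulr_sumr sum_m.
  rewrite -sumrB; apply: eq_bigr => k _; rewrite -sumrB.
  by apply: eq_bigr => l _; rewrite mulrBl.
have -> : e * (g b - g a) = \sum_(0 <= k < size s) \sum_(0 <= l < size s') e * m k l.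
  rewrite -[g b - g a](g_clamp_telescope sp (lexx a) _ (lexx b)); last exact: itv_partition_le sp.
  rewrite mulr_sumr !big_nat; apply: eq_bigr => k /andP[_ ks].
  rewrite !clamp_id; [|exact: tab (ltnW ks)|exact: tab ks].
  by rewrite -mulr_sumr sum_m'.
rewrite big_nat [leRHS]big_nat.
apply: (le_trans (ler_norm_sum _ _ _)); apply: ler_sum => k /andP[_ ks].
rewrite big_nat [leRHS]big_nat.
apply: (le_trans (ler_norm_sum _ _ _)); apply: ler_sum => l /andP[_ ls].
have t'l : t' l <= t' l.+1 by exact: itv_partition_nthS.
have tk : t k <= t k.+1 by exact: itv_partition_nthS.
have m0 : 0 <= m k l.
  have /andP[al _] := tab' _ (ltnW ls); have /andP[_ lb] := tab' _ ls.
  rewrite subr_ge0; apply: g_homo; last exact: le_clamp.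
  - have /andP[lo hi] := clamp_in (t k) t'l.
    by rewrite (le_trans al lo) (le_trans hi lb).
  - have /andP[lo hi] := clamp_in (t k.+1) t'l.
    by rewrite (le_trans al lo) (le_trans hi lb).
rewrite normrM (ger0_norm m0).
(* Disjoint cells have mass 0; the tags of overlapping cells are less than [delta + delta] apart. *)
have [lk|kl] := leP (t k.+1) (t' l).
  by rewrite /m !clamp_lo ?(le_trans tk)// subrr !mulr0.
have [kl'|lk'] := leP (t' l.+1) (t k).
  by rewrite /m !clamp_hi ?(le_trans kl')// subrr !mulr0.
apply: ler_wpM2r => //.
have [] := sxi k ks; have [] := sxi' l ls; rewrite -/(t k) -/(t k.+1) -/(t' l) -/(t' l.+1).
have /andP[? ?] := tab _ ks; have /andP[? ?] := tab _ (ltnW ks).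
have /andP[? ?] := tab' _ ls; have /andP[? ?] := tab' _ (ltnW ls).
move=> ? /andP[? ?] ? /andP[? ?].
apply: fe; [lra|lra|].
rewrite ltr_norml; apply/andP; split; lra.
Qed.

End RS_compare.

(** * Uniform partitions and existence of the integral *)

(** The left end 0 is left out, as [itv_partition] expects. *)
Definition uniform_partition (R : realType) (K : nat) : seq R :=
  [seq k%:R / K%:R | k <- iota 1 K].

Lemma size_uniform_partition (R : realType) K :
  size (uniform_partition R K) = K.
Proof. by rewrite size_map size_iota. Qed.

Lemma nth_uniform_partition (R : realType) K k : (k <= K)%N ->
  nth 1 (0 :: uniform_partition R K) k = k%:R / K%:R.
Proof.
case: k => [_|k kK]; first by rewrite mul0r.
by rewrite /= (nth_map 0%N) ?size_iota// nth_iota.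
Qed.

(** The tags are left endpoints: index i of [OWAd], counted from 0, is to be matched with the tag
    i/K. *)
Lemma uniform_partition_tagged (R : realType) (K : nat) (delta : R) :
  (0 < K)%N -> K%:R^-1 < delta ->
  tagged_partition 0 1 delta (uniform_partition R K) (fun k => k%:R / K%:R).
Proof.
move=> K0 Kdelta; have K0' : 0 < K%:R :> R by rewrite ltr0n.
have lt_step k : k%:R / K%:R < k.+1%:R / K%:R :> R.
  by rewrite ltr_pM2r ?invr_gt0// ltr_nat.
split; [split|] => [||k]; rewrite ?size_uniform_partition.
- apply/(pathP 1) => k; rewrite size_uniform_partition => kK.
  by rewrite -[nth 1 (uniform_partition R K) k]/(nth 1 (0 :: uniform_partition R K) k.+1)
    !nth_uniform_partition// ltnW.
- rewrite (last_nth 1) size_uniform_partition nth_uniform_partition//.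
  by rewrite divff// gt_eqF.
- move=> kK; rewrite !nth_uniform_partition ?(ltnW kK)//.
  by split; [rewrite -mulrBl -natrB// subSnn mul1r|rewrite lexx ltW].
Qed.

Lemma near_invn_lt (R : realType) (e : R) : 0 < e ->
  \forall n \near \oo, n%:R^-1 < e.
Proof.
move=> e0; move: (nbhs_infty_gt 0) (nbhs_infty_gtr e^-1).
by apply: filterS2 => n n0 en; rewrite invf_plt ?posrE ?ltr0n.
Qed.

Lemma near_uniform_partition_tagged (R : realType) (delta : R) : 0 < delta ->
  \forall K \near \oo, (0 < K)%N /\
    tagged_partition 0 1 delta (uniform_partition R K) (fun k => k%:R / K%:R).
Proof.
move=> delta0; move: (nbhs_infty_gt 0) (near_invn_lt delta0).
by apply: filterS2 => K K0 Kdelta; split => //; exact: uniform_partition_tagged.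
Qed.

(** Any two sums of small mesh are close by [RS_sum_close], so the sums over uniform partitions are
    Cauchy, and their limit attracts all sums of small mesh. *)
Lemma RS_integral_exists (R : realType) (f g : R -> R) :
  (forall e : R, 0 < e -> exists2 delta, 0 < delta & forall x y,
    0 <= x <= 1 -> 0 <= y <= 1 -> `|x - y| < delta -> `|f x - f y| < e) ->
  (forall x y, 0 <= x <= 1 -> 0 <= y <= 1 -> x <= y -> g x <= g y) ->
  exists I, is_RS_integral f g 0 1 I.
Proof.
move=> cf g_homo.
(* The added 1 keeps [C] positive when [g 1 = g 0] and makes the final bound strict. *)
pose C := g 1 - g 0 + 1.
have C0 : 0 < C by rewrite ltr_wpDl// subr_ge0 g_homo ?lexx ?ler01.
have close e : 0 < e -> exists2 delta, 0 < delta & forall s xi s' xi',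
    tagged_partition 0 1 delta s xi -> tagged_partition 0 1 delta s' xi' ->
    `|RS_sum f g 0 1 s xi - RS_sum f g 0 1 s' xi'| < e.
  move=> e0; have eC0 : 0 < e / C by rewrite divr_gt0.
  have [delta d0 fd] := cf _ eC0.
  exists (delta / 2) => [|s xi s' xi' sxi sxi']; first by rewrite divr_gt0.
  apply: (@le_lt_trans _ _ (e / C * (g 1 - g 0))).
    apply: RS_sum_close sxi sxi' => //; first exact: ltW.
    by move=> x y x01 y01 xy; apply/ltW/fd => //; rewrite [delta]splitr.
  by rewrite mulrAC ltr_pdivrMr// ltr_pM2l// ltrDl.
pose u n := RS_sum f g 0 1 (uniform_partition R n) (fun k => k%:R / n%:R).
have : cvg (u @ \oo).
  apply/cauchy_cvgP/cauchy_exP => e e0.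
  have [delta d0 cl] := close e e0.
  have [N _ HN] := near_uniform_partition_tagged d0.
  exists (u N), N => // n Nn.
  by apply: cl; [exact: (HN N (leqnn N)).2|exact: (HN n Nn).2].
move=> /cvgrPdist_lt uI.
exists (lim (u @ \oo)) => e e0.
have e20 : 0 < e / 2 by rewrite divr_gt0.
have [delta d0 cl] := close _ e20.
exists delta => // s xi sp sxi.
have [n [[_ tn] un]] := filter_ex (filterI (near_uniform_partition_tagged d0) (uI _ e20)).
rewrite (le_lt_trans (ler_distD (u n) _ _))// [e]splitr ltrD//.
  by apply: cl.
by rewrite distrC.
Qed.

(** * Binomial tail bound *)

(* Chernoff's bound, computed as a sum over the possible sets [B] of successes. *)
Lemma binomial_upper_tail (R : realType) (p eps : R) : 0 <= p <= 1 -> 0 < eps ->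
  exists2 r : R, 0 < r < 1 & forall K : nat,
    \sum_(B : {set 'I_K} | K%:R * (p + eps) < #|B|%:R)
      \prod_(i < K) (if i \in B then p else 1 - p) <= r ^+ K.
Proof.
move=> /andP[p0 p1] eps0.
(* The exponential parameter: l <= 1/2 gives exp(l) <= 1/(1 - l) <= 1 + l + 2l^2, and l <= eps/4
   gives 2l^2 <= l eps/2, half of the gain l eps. *)
pose l := Num.min (2^-1) (eps / 4).
have l0 : 0 < l by rewrite lt_min invr_gt0 ltr0n divr_gt0.
have l2 : l <= 2^-1 by rewrite ge_min lexx.
have l4 : l <= eps / 4 by rewrite ge_min lexx orbT.
exists (expR (- (l * eps / 2))) => [|K].
  by rewrite expR_gt0 expR_lt1 oppr_lt0 divr_gt0 ?mulr_gt0.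
have expl : expR l <= 1 + l + 2 * l ^+ 2.
  have h : (1 - l) * expR l <= 1.
    have := expR_ge1Dx (- l); rewrite expRN => h.
    by rewrite -ler_pdivlMr ?expR_gt0// mul1r.
  have h1 : 0 < 1 - l by lra.
  rewrite -(ler_pM2l h1) (le_trans h)//.
  nra.
have base : expR (- (l * (p + eps))) * (p * expR l + (1 - p)) <= expR (- (l * eps / 2)).
  have h : p * expR l + (1 - p) <= expR (l * p + 2 * l ^+ 2).
    apply: le_trans (expR_ge1Dx _).
    have : p * expR l <= p * (1 + l + 2 * l ^+ 2) by rewrite ler_wpM2l.
    have : p * l ^+ 2 <= l ^+ 2 by rewrite ler_piMl// sqr_ge0.
    lra.
  apply: (le_trans (ler_wpM2l (expR_ge0 _) h)).
  rewrite -expRD ler_expR.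
  have : l * l <= l * (eps / 4) by rewrite ler_wpM2l// ltW.
  rewrite expr2; lra.
have tilt (B : {set 'I_K}) : expR (l * #|B|%:R) * \prod_(i < K) (if i \in B then p else 1 - p)
    = \prod_(i < K) (if i \in B then p * expR l else 1 - p).
  rewrite expRM_natr -prodr_const big_mkcond -big_split/=.
  by apply: eq_bigr => i _; case: ifP => _; rewrite ?mul1r// mulrC.
(* Markov's inequality: on the tail, exp(l (#|B| - K(p + eps))) >= 1, and by [tilt] this factor
   turns each success weight p into p exp(l). The sum is then extended to all [B]. *)
apply: (@le_trans _ _ (\sum_(B : {set 'I_K}) expR (- (l * (p + eps))) ^+ K *
    \prod_(i < K) (if i \in B then p * expR l else 1 - p))).
  rewrite [leRHS](bigID (fun B : {set 'I_K} => K%:R * (p + eps) < #|B|%:R))/=.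
  apply: ler_wpDr.
    apply: sumr_ge0 => B _; apply: mulr_ge0; first exact/exprn_ge0/expR_ge0.
    apply: prodr_ge0 => i _; case: ifP => _; rewrite ?subr_ge0//.
    by rewrite mulr_ge0// expR_ge0.
  apply: ler_sum => B KB; rewrite -tilt mulrA ler_peMl//.
    by apply: prodr_ge0 => i _; case: ifP => _; rewrite ?subr_ge0.
  rewrite -expRM_natr -expRD -[X in X <= _]expR0 ler_expR.
  rewrite mulNr addrC subr_ge0 -mulrA ler_wpM2l ?(ltW l0)//.
  by rewrite mulrC ltW.
(* Over all [B] the product weights sum to (p exp(l) + 1 - p)^K, so [base] concludes. *)
rewrite -mulr_sumr -bigA_distr/= prodr_const card_ord -exprMn.
rewrite lerXn2r// nnegrE ?expR_ge0// mulr_ge0 ?expR_ge0//.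
by rewrite addr_ge0 ?subr_ge0// mulr_ge0// expR_ge0.
Qed.

(** * Almost sure bounds on empirical frequencies *)

Definition hits (R : realType) (K : nat) (y : 'I_K -> R) (A : set R) : {set 'I_K} :=
  finset (fun i => y i \in A).

(** Puts the event in the form to which mutual independence applies, with [A] or its complement at
    each index. *)
Lemma hits_eqE (R : realType) d (T : measurableType d) (P : probability T R)
    (K : nat) (Y : 'I_K -> {RV P >-> R}) (A : set R) (B : {set 'I_K}) :
  [set w | hits (fun i => Y i w) A = B] =
  \bigcap_(i in [set` [set: 'I_K]%SET]) (Y i @^-1` (if i \in B then A else ~` A)).
Proof.
apply/seteqP; split => [w /= <- i _|w YB].
  rewrite /hits inE; case: ifPn; first by rewrite inE.
  by move=> /negP; rewrite inE.
apply/setP => i; rewrite inE.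
have := YB i; rewrite /= inE => /(_ isT); case: ifPn => _ /=.
  by move=> ?; rewrite mem_set.
by move=> ?; apply/negbTE/negP; rewrite inE.
Qed.

Lemma measurable_hits_eq (R : realType) d (T : measurableType d) (P : probability T R)
    (K : nat) (Y : 'I_K -> {RV P >-> R}) (A : set R) (B : {set 'I_K}) :
  measurable A -> measurable [set w | hits (fun i => Y i w) A = B].
Proof.
move=> mA; rewrite hits_eqE; apply: fin_bigcap_measurable => // i _.
apply: measurable_funPTI => //.
by case: ifP => // _; exact: measurableC.
Qed.

Lemma probability_hits_eq (R : realType) d (T : measurableType d) (P : probability T R)
    (K : nat) (Y : 'I_K -> {RV P >-> R}) (A : set R) (p : R) (B : {set 'I_K}) :
  mutually_independent Y -> measurable A ->
  (forall i, P (Y i @^-1` A) = p%:E) ->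
  P [set w | hits (fun i => Y i w) A = B] = (\prod_(i < K) (if i \in B then p else 1 - p))%:E.
Proof.
move=> indY mA PA; rewrite hits_eqE indY => [|i]; last first.
  by case: ifP => // _; exact: measurableC.
rewrite -prodEFin; apply: eq_big => [i|i _]; first by rewrite inE.
case: ifP => // _; rewrite preimage_setC probability_setC ?PA//.
exact: measurable_funPTI.
Qed.

Lemma measure_bigsetU_le (R : realType) d (T : measurableType d) (mu : {measure set T -> \bar R})
    (I : finType) (S : pred I) (F : I -> set T) : (forall i, measurable (F i)) ->
  (mu (\big[setU/set0]_(i | S i) F i) <= \sum_(i | S i) mu (F i))%E.
Proof.
move=> mF.
(* Measurability is carried through the induction because [measureU2] needs it. *)
suff [] : measurable (\big[setU/set0]_(i | S i) F i) /\
  (mu (\big[setU/set0]_(i | S i) F i) <= \sum_(i | S i) mu (F i))%E by [].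
elim/big_rec2 : _ => [|i x A _ [mA Ax]]; first by rewrite measure0.
split; first exact: measurableU.
by rewrite (le_trans (measureU2 _ _ _))// leeD2l.
Qed.

(** Splits a tail event by the exact set of hits, so that its probability is bounded by the sum in
    [binomial_upper_tail]. *)
Lemma hits_predE (R : realType) d (T : measurableType d) (P : probability T R)
    (K : nat) (Y : 'I_K -> {RV P >-> R}) (A : set R) (S : pred {set 'I_K}) :
  [set w | S (hits (fun i => Y i w) A)] =
  \big[setU/set0]_(B | S B) [set w | hits (fun i => Y i w) A = B].
Proof.
rewrite -[RHS]bigcup_pred; apply/seteqP; split => [w /= Sw|w [B SB /= ->//]].
by exists (hits (fun i => Y i w) A).
Qed.

Lemma geometric_nneseries_lty (R : realType) (r : R) : 0 < r < 1 ->
  (\sum_(0 <= n <oo) (r ^+ n)%:E < +oo)%E.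
Proof.
move=> /andP[r0 r1]; have r1' : 0 < 1 - r by rewrite subr_gt0.
apply: (@le_lt_trans _ _ ((1 - r)^-1)%:E); last by rewrite ltry.
apply: lime_le.
  by apply: is_cvg_nneseries => n _ _; rewrite lee_fin exprn_ge0// ltW.
apply: nearW => n; rewrite sumEFin lee_fin big_mkord.
rewrite -[_^-1]mul1r ler_pdivlMr// mulrC -opprB mulNr -subrX1 opprB.
by rewrite gerBl exprn_ge0// ltW.
Qed.

(** Borel-Cantelli: by Chernoff's bound the exceptional event [F K] has probability at most r^K,
    which is summable. *)
Lemma ae_hits_le (R : realType) d (T : measurableType d) (P : probability T R)
    (v : forall K : nat, 'I_K -> {RV P >-> R}) (A : set R) (p eps : R) :
  (forall K, mutually_independent (v K)) -> measurable A -> 0 <= p <= 1 ->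
  (forall K i, P (v K i @^-1` A) = p%:E) -> 0 < eps ->
  {ae P, forall w, \forall K \near \oo,
     #|hits (fun i => v K i w) A|%:R <= K%:R * (p + eps)}.
Proof.
move=> indv mA p01 PA eps0.
have [r r01 rP] := binomial_upper_tail p01 eps0.
pose S K (B : {set 'I_K}) := K%:R * (p + eps) < #|B|%:R.
pose F K := [set w | S K (hits (fun i => v K i w) A)].
have mF K : measurable (F K).
  rewrite /F hits_predE; apply: bigsetU_measurable => B _.
  exact: measurable_hits_eq.
exists (lim_sup_set F); split.
- by apply: bigcap_measurable => // n _; exact: bigcup_measurable.
- apply: lim_sup_set_cvg0 => //.
  apply: le_lt_trans (geometric_nneseries_lty r01).
  apply: lee_nneseries => [|K _]; first by [].
  rewrite /F hits_predE (le_trans (measure_bigsetU_le _ _ _))//.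
    by move=> B; exact: measurable_hits_eq.
  rewrite (eq_bigr _ (fun B _ => probability_hits_eq B (indv K) mA (PA K))).
  by rewrite sumEFin lee_fin rP.
- move=> w /= nw n _; apply: contrapT => nF; apply: nw.
  exists n => // K /= nK; rewrite leNgt; apply/negP => SK.
  by apply: nF; exists K.
Qed.

(** There are only countably many pairs (K, i), so the null events add up to a null event. *)
Lemma ae_notin_null (R : realType) d (T : measurableType d) (P : probability T R)
    (v : forall K : nat, 'I_K -> {RV P >-> R}) (A : set R) :
  measurable A -> (forall K i, P (v K i @^-1` A) = 0) ->
  {ae P, forall w, forall K i, ~ A (v K i w)}.
Proof.
move=> mA PA; apply/ae_foralln => K; apply: filter_forall => i.
exists (v K i @^-1` A); split; [exact: measurable_funPTI|exact: PA|].
by move=> w /= /contrapT.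
Qed.

(** * Tail probabilities at the quantiles *)

Section VaR_tails.
Variables (R : realType) (d : measure_display) (T : measurableType d).
Variables (P : probability T R) (X : {RV P >-> R}) (xlo xhi : R).
Hypothesis X_bounded : P (X @^-1` `[xlo, xhi]) = 1%E.

(** With [cdf_lower_bound], this makes the sets in [VaR] nonempty and bounded below for t in
    [0, 1]. *)
Lemma cdf_upper_bound : cdf X xhi = 1%E.
Proof.
apply/eqP; rewrite eq_le cdf_le1/= -X_bounded.
apply: (le_measure P); rewrite ?inE.
- exact: measurable_funPTI.
- exact: measurable_funPTI.
- by move=> w /=; rewrite !in_itv/= => /andP[].
Qed.

Lemma cdf_lower_bound (y : R) : (0 < cdf X y)%E -> xlo <= y.
Proof.
rewrite leNgt => Fy; apply/negP => ylo; move: Fy; rewrite ltNge => /negP; apply.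
have mI : measurable (X @^-1` `[xlo, xhi]) by exact: measurable_funPTI.
rewrite -[leRHS](subee (x := 1%E))// -{2}X_bounded -probability_setC//.
apply: (le_measure P); rewrite ?inE.
- exact: measurable_funPTI.
- exact: measurableC.
- move=> w /=; rewrite !in_itv/= => wy; rewrite (leNgt xlo) => /andP[/negP].
  by move=> + _; apply; exact: le_lt_trans ylo.
Qed.

(** For t > 0, some y < VaR_t + e has F(y) >= t, and the tail beyond VaR_t + e lies in {X > y}. For
    t = 0 the bound is 1. At t = 1 the tail is null. *)
Lemma VaR_upper_tail (t e : R) : 0 <= t <= 1 -> 0 < e ->
  (P (X @^-1` `](VaR X t + e)%R, +oo[) <= (1 - t)%:E)%E.
Proof.
move=> /andP[t0 t1] e0; rewrite /VaR; case: eqP => [->|/eqP tn0].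
  by rewrite subr0 probability_le1//; exact: measurable_funPTI.
have t_gt0 : 0 < t by rewrite lt_neqAle eq_sym tn0.
have hinf : has_inf [set y : R | (t%:E <= cdf X y)%E].
  split; first by exists xhi; rewrite /= cdf_upper_bound lee_fin.
  by exists xlo => y /= ty; apply: cdf_lower_bound; rewrite (lt_le_trans _ ty)// lte_fin.
have [y /= ty yinf] := inf_adherent e0 hinf.
apply: (@le_trans _ _ (ccdf X y)).
  apply: (le_measure P); rewrite ?inE; [exact: measurable_funPTI|exact: measurable_funPTI|].
  by move=> w /=; rewrite !in_itv/= !andbT; exact: lt_trans.
by rewrite ccdf_1_cdf EFinB leeB.
Qed.

(** If F(VaR_t - e) > t, then VaR_t - e lies in the set of which VaR_t is the infimum. At t = 0 the
    strict inequality in [VaR] makes this work and the tail is null. *)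
Lemma VaR_lower_tail (t e : R) : 0 <= t <= 1 -> 0 < e ->
  (P (X @^-1` `]-oo, (VaR X t - e)%R]) <= t%:E)%E.
Proof.
move=> /andP[t0 t1] e0; rewrite leNgt; apply/negP => tF.
have {tF} tF : (t%:E < cdf X (VaR X t - e))%E by [].
suff : VaR X t <= VaR X t - e by move=> h; lra.
rewrite {1}/VaR; case: eqP => [t00|/eqP tn0]; apply: ge_inf => /=.
- by exists xlo => y /=; exact: cdf_lower_bound.
- by move: tF; rewrite t00.
- exists xlo => y /= ty; apply: cdf_lower_bound; rewrite (lt_le_trans _ ty)// lte_fin.
  by rewrite lt_neqAle eq_sym tn0.
- exact: ltW.
Qed.

End VaR_tails.

(** * Locating the order statistics *)

Section order_statistics.
Variables (R : realType) (K : nat) (y : 'I_K -> R) (s : 'S_K).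
Hypothesis sorted_s : is_sorting_perm y s.

Let s_homo (i j : 'I_K) : (i <= j)%N -> y (s j) <= y (s i).
Proof. by move=> ij; move: sorted_s => /forallP/(_ i)/forallP/(_ j)/implyP; exact. Qed.

(** Otherwise the samples in sorted positions 0 to i all exceed [c], which makes i + 1 hits. *)
Lemma sorted_le_of_hits (c : R) (i : 'I_K) :
  (#|hits y `]c, +oo[| <= i)%N -> y (s i) <= c.
Proof.
rewrite leNgt => hi; apply/negP => ci; move: hi; rewrite leqNgt => /negP; apply.
pose f (j : 'I_i.+1) := s (widen_ord (ltn_ord i) j).
have f_inj : injective f by move=> j k /perm_inj /(congr1 val) /= /val_inj.
rewrite -[X in (X <= _)%N]card_ord -cardsT -(card_imset _ f_inj).
apply/subset_leq_card/fintype.subsetP => _ /imsetP[j _ ->].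
rewrite inE mem_set//= in_itv/= andbT (lt_le_trans ci)//.
by apply: s_homo; rewrite /= -ltnS.
Qed.

(** Otherwise every sample above [c] sits in a sorted position before i, so at most i samples miss
    and at least K - i hit. *)
Lemma sorted_gt_of_hits (c : R) (i : 'I_K) :
  (#|hits y `]-oo, c]| < K - i)%N -> c < y (s i).
Proof.
rewrite ltNge => hi; apply/negP => ic; move: hi; rewrite ltnNge => /negP; apply.
pose f (j : 'I_i) := s (widen_ord (ltnW (ltn_ord i)) j).
have sub : ~: hits y `]-oo, c] \subset [set f j | j in [set: 'I_i]%SET]%SET.
  apply/fintype.subsetP => k; rewrite !inE => /negP; rewrite inE /= in_itv/= => /negP.
  rewrite -ltNge => ck; have ki : ((s^-1)%g k < i)%N.
    rewrite ltnNge; apply/negP => /s_homo; rewrite permKV leNgt.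
    by rewrite (le_lt_trans ic).
  apply/imsetP; exists (Ordinal ki); rewrite ?inE// /f.
  have -> : widen_ord (ltnW (ltn_ord i)) (Ordinal ki) = (s^-1)%g k by apply: val_inj.
  by rewrite permKV.
have := leq_trans (subset_leq_card sub) (leq_imset_card _ _).
rewrite cardsT card_ord => h.
by rewrite leq_subLR -{1}(card_ord K) -(cardsC (hits y `]-oo, c])) addnC leq_add2r.
Qed.

End order_statistics.

(** With u = 1 - i/K in the grid cell [x/m, (x+1)/m), the grid points (x+2)/m and (x-2)/m bound the
    order statistic from above and below. Both are within 3/m of u. Where they leave [0, 1], the
    almost sure bounds on all samples replace them. *)
Lemma order_statistic_close (R : realType) (q : R -> R) (eta delta : R) (m K : nat)
    (y : 'I_K -> R) (s : 'S_K) : (0 < m)%N -> 3 / m%:R < delta ->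
  (forall t u, 0 <= t <= 1 -> 0 <= u <= 1 -> `|t - u| < delta -> `|q t - q u| < eta) ->
  is_sorting_perm y s ->
  (forall j : nat, (j <= m)%N ->
    #|hits y `]q (j%:R / m%:R) + m%:R^-1, +oo[|%:R <=
      K%:R * (1 - j%:R / m%:R + m%:R^-1) :> R) ->
  (forall j : nat, (j <= m)%N ->
    #|hits y `]-oo, q (j%:R / m%:R) - m%:R^-1]|%:R <=
      K%:R * (j%:R / m%:R + m%:R^-1) :> R) ->
  (forall i, y i <= q 1 + m%:R^-1) -> (forall i, q 0 - m%:R^-1 < y i) ->
  forall i : 'I_K, `|y (s i) - q (1 - i%:R / K%:R)| < eta + m%:R^-1.
Proof.
move=> m0; set c := m%:R^-1 => cdelta q_uc ss up lo up1 lo0 i.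
set u := 1 - i%:R / K%:R.
have m0' : 0 < m%:R :> R by rewrite ltr0n.
have c0 : 0 < c by rewrite invr_gt0.
have mc : m%:R * c = 1 by rewrite divff// gt_eqF.
have K0 : 0 < K%:R :> R by rewrite ltr0n (leq_ltn_trans (leq0n i)).
have iK : i%:R / K%:R < 1 :> R by rewrite ltr_pdivrMr// mul1r ltr_nat.
have i0 : 0 <= i%:R / K%:R :> R by rewrite divr_ge0.
have Ku : K%:R * (1 - u) = i%:R by rewrite /u subKr mulrCA divff ?gt_eqF// mulr1.
have u0 : 0 < u by rewrite subr_gt0.
have u1 : u <= 1 by rewrite gerBl.
have := truncn_itv (mulr_ge0 (ltW m0') (ltW u0)).
have uE : u = m%:R * u * c by rewrite mulrAC mc mul1r.
set x := Num.truncn (m%:R * u) => /andP[xu ux].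
have xSE : x.+1%:R * c = x%:R * c + c by rewrite -natr1 mulrDl mul1r.
have {}xu : x%:R * c <= u by rewrite [leRHS]uE ler_wpM2r// ltW.
have {}ux : u < x%:R * c + c by rewrite -xSE [ltLHS]uE ltr_pM2r.
have ub : y (s i) < q u + eta + c.
  have [xm|mx] := leqP x.+2 m.
    have jc : x.+2%:R * c = x%:R * c + 2 * c :> R by rewrite -mulrDl -natrD addn2.
    have j1 : x.+2%:R * c <= 1 by rewrite -[leRHS]mc ler_wpM2r ?(ltW c0)// ler_nat.
    (* At j = x+2 the allowed fraction is 1 - (x+1)/m, below 1 - u = i/K. *)
    have : y (s i) <= q (x.+2%:R * c) + c.
      apply: (sorted_le_of_hits ss); rewrite -(ler_nat R) (le_trans (up _ xm))//.
      rewrite -Ku ler_wpM2l ?(ltW K0)//; lra.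
    have : `|q (x.+2%:R * c) - q u| < eta.
      apply: q_uc; [lra|lra|]; rewrite ltr_norml; lra.
    rewrite ltr_norml; lra.
  have xm : 1 <= x%:R * c + c by rewrite -xSE -[X in X <= _]mc ler_wpM2r ?(ltW c0)// ler_nat.
  have : `|q 1 - q u| < eta.
    apply: q_uc; [lra|lra|]; rewrite ltr_norml; lra.
  have := up1 (s i); rewrite ltr_norml; lra.
have lb : q u - eta - c < y (s i).
  have [xm|mx] := leqP 2 x.
    have jc : (x - 2)%:R * c = x%:R * c - 2 * c :> R by rewrite natrB// mulrBl.
    have jm : (x - 2 <= m)%N.
      rewrite -(ler_nat R) -(ler_pM2r c0) mc.
      by rewrite jc; lra.
    (* At j = x-2 the allowed fraction is (x-1)/m, strictly below u; x-1 would only give x/m <= u,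
       and the count must be strictly below K - i = K u. *)
    have : q ((x - 2)%:R * c) - c < y (s i).
      apply: (sorted_gt_of_hits ss); rewrite -(ltr_nat R) (le_lt_trans (lo _ jm))//.
      rewrite [(K - i)%:R]natrB ?(ltnW (ltn_ord i))// -Ku -[X in _ < X - _]mulr1 -mulrBr subKr.
      rewrite ltr_pM2l//; lra.
    have j0 : 0 <= (x - 2)%:R * c by rewrite mulr_ge0 ?(ltW c0).
    have : `|q ((x - 2)%:R * c) - q u| < eta.
      apply: q_uc; [lra|lra|]; rewrite ltr_norml; lra.
    rewrite ltr_norml; lra.
  have x1 : x%:R <= 1 :> R by rewrite lern1 -ltnS.
  have xc : x%:R * c <= c by rewrite -[leRHS]mul1r ler_wpM2r// ltW.
  have : `|q 0 - q u| < eta.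
    apply: q_uc; [lra|lra|]; rewrite ltr_norml; lra.
  have := lo0 (s i); rewrite ltr_norml; lra.
rewrite ltr_norml; lra.
Qed.

(** * From order statistics to the risk measure *)

(** Both sums carry the same nonnegative weights [dQ i] of total 1, so their difference is a
    weighted average of the pointwise errors. *)
Lemma OWAd_uniform_RS_sum (R : realType) (Q f : R -> R) (K : nat) (y : 'I_K -> R)
    (b : R) : BUM Q -> (0 < K)%N ->
  (forall i : 'I_K, `|y (sorting_perm y i) - f (i%:R / K%:R)| <= b) ->
  `|OWAd Q y - RS_sum f Q 0 1 (uniform_partition R K) (fun k => k%:R / K%:R)| <= b.
Proof.
move=> [_ Q0 Q1 Qhomo] K0 yf.
have K0' : 0 < K%:R :> R by rewrite ltr0n.
pose dQ (k : nat) := Q (k.+1%:R / K%:R) - Q (k%:R / K%:R).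
have dQ0 (i : 'I_K) : 0 <= dQ i.
  have in01 k : (k <= K)%N -> 0 <= (k%:R / K%:R : R) <= 1.
    by move=> kK; rewrite divr_ge0//= ler_pdivrMr// mul1r ler_nat.
  rewrite subr_ge0; apply: Qhomo; [exact: in01|by rewrite in01// ltnW|].
  by rewrite ltr_pM2r ?invr_gt0// ltr_nat.
have -> : RS_sum f Q 0 1 (uniform_partition R K) (fun k => k%:R / K%:R) =
    \sum_(i < K) dQ i * f (i%:R / K%:R).
  rewrite /RS_sum size_uniform_partition big_mkord; apply: eq_bigr => i _.
  by rewrite !nth_uniform_partition// ?(ltnW (ltn_ord i))// mulrC.
have sum_dQ : \sum_(i < K) dQ i = 1.
  rewrite -(big_mkord xpredT dQ) (telescope_sumr (fun k => Q (k%:R / K%:R)))//.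
  by rewrite divff ?gt_eqF// mul0r Q1 Q0 subr0.
rewrite /OWAd -sumrB (le_trans (ler_norm_sum _ _ _))//.
have -> : b = \sum_(i < K) dQ i * b by rewrite -mulr_suml sum_dQ mul1r.
apply: ler_sum => i _.
by rewrite -mulrBr normrM ger0_norm ?dQ0// ler_wpM2l ?dQ0.
Qed.

Lemma sorting_permP (R : realType) (K : nat) (y : 'I_K -> R) :
  is_sorting_perm y (sorting_perm y).
Proof. exact: xchooseP. Qed.

Theorem theorem1 (R : realType)
  (d : measure_display) (T : measurableType d) (P : probability T R)
  (X : {RV P >-> R}) (Q : R -> R)
  (d' : measure_display) (Omega : measurableType d') (Pr : probability Omega R)
  (v : forall K : nat, 'I_K -> {RV Pr >-> R}) :
  assumptionA1 X ->
  BUM Q ->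
  (forall K : nat, iid_samples X (v K)) ->
  {ae Pr, forall w,
    (fun K : nat => OWAd Q (fun i : 'I_K => v K i w)) @ \oo -->
      distortion_risk Q X}.
Proof.
move=> [[xlo [xhi Xb]] cq] BQ iid.
pose q := VaR X.
have q_uc := within_segment_uniformly_continuous cq.
have f_uc (e : R) : 0 < e -> exists2 delta, 0 < delta & forall x y,
    0 <= x <= 1 -> 0 <= y <= 1 -> `|x - y| < delta -> `|q (1 - x) - q (1 - y)| < e.
  move=> /q_uc[delta d0 H]; exists delta => // x y x01 y01 xy.
  apply: H; [lra|lra|]; rewrite distrC.
  by have -> : 1 - y - (1 - x) = x - y by ring.
have Qhomo x y : 0 <= x <= 1 -> 0 <= y <= 1 -> x <= y -> Q x <= Q y.
  have [_ _ _ H] := BQ.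
  by move=> x01 y01; rewrite le_eqVlt => /predU1P[->//|]; exact: H.
(* Existence of the integral rules out the default value 0 of [xget]. *)
have Iint : is_RS_integral (fun t => q (1 - t)) Q 0 1 (distortion_risk Q X).
  exact: (@xgetPex _ 0 [set I | is_RS_integral _ Q 0 1 I] (RS_integral_exists f_uc Qhomo)).
(* [ae_hits_le] is applied with the exact probability of [A], transferred to the samples by equality
   of laws, and then relaxed to [b]. *)
have freq (A : set R) (b e : R) : measurable A -> 0 < e ->
    (P (X @^-1` A) <= b%:E)%E ->
    {ae Pr, forall w, \forall K \near \oo,
      #|hits (fun i => v K i w) A|%:R <= K%:R * (b + e)}.
  move=> mA e0 PAb.
  have mXA : measurable (X @^-1` A) by exact: measurable_funPTI.
  have PAE : (fine (P (X @^-1` A)))%:E = P (X @^-1` A) by rewrite fineK// fin_num_measure.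
  have p01 : 0 <= fine (P (X @^-1` A)) <= 1.
    by rewrite -!lee_fin PAE measure_ge0 probability_le1.
  have pb : fine (P (X @^-1` A)) <= b by rewrite -lee_fin PAE.
  have PvA K i : Pr (v K i @^-1` A) = (fine (P (X @^-1` A)))%:E.
    by rewrite PAE; exact: (iid K).2.
  have := ae_hits_le (fun K => (iid K).1) mA p01 PvA e0.
  apply: filterS => w; apply: filterS => K /le_trans; apply.
  by rewrite ler_wpM2l// lerD2r.
have null (A : set R) : measurable A -> P (X @^-1` A) = 0 ->
    {ae Pr, forall w, forall K i, ~ A (v K i w)}.
  move=> mA PA0; apply: ae_notin_null => // K i.
  by rewrite -PA0; exact: (iid K).2.
(* The grid is j/(m+1) with 0 <= j <= m+1, hence the index type ['I_m.+2]. *)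
pose c m : R := m.+1%:R^-1.
have c0 m : 0 < c m by rewrite invr_gt0.
have in01 m (j : 'I_m.+2) : 0 <= j%:R * c m <= 1.
  rewrite mulr_ge0 ?(ltW (c0 m))//= ler_pdivrMr// mul1r ler_nat -ltnS ltn_ord//.
(* Countably many meshes and finitely many grid points each: one null set serves them all, so m may
   later depend on the error e. *)
have up : {ae Pr, forall w, forall m (j : 'I_m.+2), \forall K \near \oo,
    #|hits (fun i => v K i w) `]q (j%:R * c m) + c m, +oo[|%:R
      <= K%:R * (1 - j%:R * c m + c m)}.
  apply/ae_foralln => m; apply: filter_forall => j; apply: freq => //.
  exact: (VaR_upper_tail Xb).
have lo : {ae Pr, forall w, forall m (j : 'I_m.+2), \forall K \near \oo,
    #|hits (fun i => v K i w) `]-oo, q (j%:R * c m) - c m]|%:R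
      <= K%:R * (j%:R * c m + c m)}.
  apply/ae_foralln => m; apply: filter_forall => j; apply: freq => //.
  exact: (VaR_lower_tail Xb).
have up1 : {ae Pr, forall w, forall m K i, ~ `]q 1 + c m, +oo[%classic (v K i w)}.
  apply/ae_foralln => m; apply: null => //; apply/eqP.
  rewrite eq_le measure_ge0 andbT (le_trans (VaR_upper_tail Xb _ (c0 _)))//.
  by rewrite ler01 lexx.
have lo0 : {ae Pr, forall w, forall m K i, ~ `]-oo, q 0 - c m]%classic (v K i w)}.
  apply/ae_foralln => m; apply: null => //; apply/eqP.
  rewrite eq_le measure_ge0 andbT (le_trans (VaR_lower_tail Xb _ (c0 _)))//.
  by rewrite ler01 lexx.
have bounds : {ae Pr, forall w, forall m K i, q 0 - c m < v K i w <= q 1 + c m}.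
  move: up1 lo0; apply: filterS2 => w up1w lo0w m K i; rewrite !ltNge.
  apply/andP; split; [apply/negP => h; apply: (lo0w m K i)|].
    by rewrite /= in_itv.
  by rewrite leNgt; apply/negP => h; apply: (up1w m K i); rewrite /= in_itv/= andbT.
move: up lo bounds; apply: filterS3 => w upw low boundsw.
apply/cvgrPdist_lt => e e0.
(* Error budget: e/2 for the Riemann-Stieltjes sum, and e/4 + [c m] < e/2 for the order statistics.
   The bound [c m] < delta/3 meets the condition 3/(m+1) < delta. *)
have e20 : 0 < e / 2 by rewrite divr_gt0.
have e40 : 0 < e / 4 by rewrite divr_gt0.
have [delta1 d10 Hint] := Iint _ e20.
have [delta d0 Hq] := q_uc _ e40.
have d30 : 0 < delta / 3 by rewrite divr_gt0.
have [m [cm4 cmd]] : exists m, c m < e / 4 /\ c m < delta / 3.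
  have [[|n] [n0 [n1 n2]]] := filter_ex (filterI (nbhs_infty_gt 0)
    (filterI (near_invn_lt e40) (near_invn_lt d30))); first by [].
  by exists n.
move: (filter_forall eventually_filter (upw m))
  (filter_forall eventually_filter (low m)) (near_uniform_partition_tagged d10).
apply: filterS3 => K upK loK [K0 [Kpart Ktags]].
have close (i : 'I_K) : `|v K (sorting_perm (fun i => v K i w) i) w - q (1 - i%:R / K%:R)| <= e / 2.
  apply: ltW; apply: (@lt_trans _ _ (e / 4 + c m)); last lra.
  apply: (@order_statistic_close _ q _ delta m.+1 K (fun i => v K i w)) => //.
  - rewrite -/(c m); lra.
  - exact: sorting_permP.
  - by move=> j jm; exact: (upK (Ordinal (jm : (j < m.+2)%N))).
  - by move=> j jm; exact: (loK (Ordinal (jm : (j < m.+2)%N))).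
  - by move=> j; have /andP[] := boundsw m K j.
  - by move=> j; have /andP[] := boundsw m K j.
rewrite distrC (le_lt_trans (ler_distD (RS_sum (fun t => q (1 - t)) Q 0 1
  (uniform_partition R K) (fun k => k%:R / K%:R)) _ _))//.
rewrite [e]splitr ler_ltD//.
  exact: OWAd_uniform_RS_sum close.
exact: Hint.
Qed.
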